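(* Let $X$ be an infinite, non-discrete Fréchet–Urysohn space. The hyperspace $\mathcal{S}_c(X)$ of nontrivial convergent sequences of $X$, with the Vietoris topology, is connected if and only if $X$ is connected.
   Context: For a topological space $X$, $\mathcal{CL}(X)$ denotes the set of all nonempty closed subsets of $X$. For a nonempty family $\mathcal{U}$ of subsets of $X$, $\langle \mathcal{U}\rangle = \{F \in \mathcal{CL}(X) : F \subseteq \bigcup \mathcal{U} \text{ and } F \cap U \neq \emptyset \text{ for all } U \in \mathcal{U}\}$. The Vietoris topology on $\mathcal{CL}(X)$ has as a base the sets $\langle \mathcal{U}\rangle$, where $\mathcal{U}$ runs over all nonempty finite families of nonempty open subsets of $X$; every subset of $\mathcal{CL}(X)$ carries the subspace topology. A nontrivial convergent sequence of $X$ is a subset $S \subseteq X$ such that $|S| = \omega$ (countably infinite), $S$ has a unique non-isolated point $x_S$, and $S \setminus U$ is finite for each neighborhood $U$ of $x_S$. Then $\mathcal{S}_c(X) = \{S \in \mathcal{CL}(X) : S \text{ is a nontrivial convergent sequence}\}$. A space $X$ is Fréchet–Urysohn if whenever $A\subseteq X$ and $x \in \overline{A}$, there is a sequence of points of $A$ converging to $x$.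
   Formalization: The space X is additionally assumed to be Hausdorff; without this the claim fails, e.g. for the disjoint sum of two countably infinite cofinite spaces, where the hyperspace of nontrivial convergent sequences is empty (hence connected) but X is not connected. *)

(* Defs.v *)
From HB Require Import structures.
From mathcomp Require Import all_boot all_order.
From mathcomp Require Import mathcomp_extra boolp classical_sets functions.
From mathcomp Require Import cardinality filter topology.

Set Implicit Arguments.
Unset Strict Implicit.
Unset Printing Implicit Defensive.

Local Open Scope classical_set_scope.

Definition CL (X : topologicalType) : Type :=
  set_type [set F : set X | closed F /\ F !=set0].

HB.instance Definition _ (X : topologicalType) := Choice.copy (CL X)
  (set_type [set F : set X | closed F /\ F !=set0]).

(* The topology given to [CL X] below is the Vietoris topology, not the
   topology that [set_type] would inherit from the function space [X -> Prop]. *)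
Definition CL_set (X : topologicalType) (F : CL X) : set X := val F.
Coercion CL_set : CL >-> set.

(* [vietoris U] is the set written <U> in the literature. *)
Definition vietoris (X : topologicalType) (U : set (set X)) : set (CL X) :=
  [set F : CL X | (F : set X) `<=` \bigcup_(V in U) V /\
                  forall V, U V -> F `&` V !=set0].

Definition vietoris_index (X : topologicalType) : set (set (set X)) :=
  [set U | [/\ finite_set U, U !=set0 &
               forall V, U V -> open V /\ V !=set0]].

Section vietoris_topology.
Variable X : topologicalType.

Lemma vietoris_cover : \bigcup_(U in @vietoris_index X) vietoris U = setT.
Proof.
apply/seteqP; split=> // F _.
have [_ [x Fx]] : closed (F : set X) /\ (F : set X) !=set0 := set_mem (valP F).
exists [set setT].
  split; [exact: finite_set1 | by exists setT |].
  by move=> _ ->; split; [exact: openT | exists x].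
split=> [y _|_ ->]; first by exists setT.
by exists x.
Qed.

Lemma vietoris_join (U V : set (set X)) (F : CL X) :
  vietoris_index U -> vietoris_index V -> vietoris U F -> vietoris V F ->
  exists W, [/\ vietoris_index W, vietoris W F &
                vietoris W `<=` vietoris U `&` vietoris V].
Proof.
move=> [finU [U0 UU0] oU] [finV _ oV] [FU FmU] [FV FmV].
pose bU := \bigcup_(A in U) A; pose bV := \bigcup_(A in V) A.
have obU : open bU by apply: bigcup_open => A /oU[].
have obV : open bV by apply: bigcup_open => A /oV[].
pose W := [set A `&` bV | A in U] `|` [set A `&` bU | A in V].
have FmW A : W A -> F `&` A !=set0.
  move=> [] [B BU <-].
    by have [x [Fx Bx]] := FmU _ BU; exists x; split=> //; split=> //; apply: FV.
  by have [x [Fx Bx]] := FmV _ BU; exists x; split=> //; split=> //; apply: FU.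
exists W; split.
- split.
  + by rewrite finite_setU; split; exact: finite_image.
  + by exists (U0 `&` bV); left; exists U0.
  + move=> A WA; split; last by have [x []] := FmW _ WA; exists x.
    case: WA => [] [B BU <-]; apply: openI => //; first by have [] := oU _ BU.
    by have [] := oV _ BU.
- split=> // x Fx; have [A UA Ax] := FU _ Fx.
  by exists (A `&` bV); [left; exists A | split=> //; apply: FV].
- move=> G [GW GmW]; split; split.
  + move=> x /GW[A [] [B BU <-] []]; first by exists B.
    by [].
  + move=> A UA; have [|x [Gx []]] := GmW (A `&` bV); first by left; exists A.
    by exists x.
  + move=> x /GW[A [] [B BU <-] []]; first by [].
    by exists B.
  + move=> A VA; have [|x [Gx []]] := GmW (A `&` bU); first by right; exists A.
    by exists x.
Qed.

HB.instance Definition _ := isBaseTopological.Build (CL X)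
  vietoris_cover vietoris_join.

Lemma open_vietoris (O : set (CL X)) :
  open O <-> exists2 B, B `<=` @vietoris_index X &
                        \bigcup_(U in B) vietoris U = O.
Proof. by split=> -[B sB BO]; exists B. Qed.

End vietoris_topology.

Definition nontrivial_convergent_sequence (X : topologicalType) (S : set X) :=
  (S #= [set: nat])%card /\
  exists x, [/\ S x /\ ~ isolated S x,
                forall y, S y -> ~ isolated S y -> y = x &
                forall U, nbhs x U -> finite_set (S `\` U)].

(* A subset of [CL X]: [connected (Sc X)] refers to relatively clopen subsets,
   i.e. to the subspace topology. *)
Definition Sc (X : topologicalType) : set (CL X) :=
  [set S : CL X | nontrivial_convergent_sequence (S : set X)].

Arguments Sc X : clear implicits.

Definition frechet_urysohn (X : topologicalType) :=
  forall (A : set X) (x : X), closure A x ->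
    exists u : nat -> X, (forall n, A (u n)) /\ u @ \oo --> x.

Definition discrete_space (X : topologicalType) := forall A : set X, open A.

(* Main.v *)
Require Import Defs.
From HB Require Import structures.
From mathcomp Require Import all_boot all_order.
From mathcomp Require Import mathcomp_extra boolp classical_sets functions.
From mathcomp Require Import cardinality filter topology.

Local Open Scope classical_set_scope.

(** If X is a disjoint union of nonempty clopen sets A and A', a non-isolated
point p lies in one of them, say A, and some nontrivial sequence S converging
to p lies in A.  The sequences contained in A form a relatively clopen subset
of the hyperspace ([open_CL_subset], [open_CL_meets]); it contains S, but not
S with a point of A' added, which is still a convergent sequence.  So the
hyperspace is not connected ([connected_of_Sc]).

Conversely, let X be connected and let B be a relatively clopen set of
convergent sequences.  Three observations show that B is everything or empty.

Adding a point: x |-> S `|` [set x] is a continuous map from the connected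
space X ([add_point_continuous]) whose image contains S (take for x the limit
of S).  So if S is in B, then so are all its finite enlargements
([clopen_add_seq]).

Same limit: any larger sequence T converging to the limit of S is a Vietoris
limit of finite enlargements of S, hence is in B too.  Two sequences S and T
with the same limit are both contained in S `|` T, so they are both in B or
both outside ([clopen_same_limit]).  Whether a sequence is in B thus depends
only on its limit.

Moving the limit: let D be the set of limits of members of B, let x be in its
closure and let T converge to x.  A Vietoris neighbourhood of T contains every
set obtained from a suitable finite subset of T by adding a sequence that
converges to a point d of D close to x and stays close to x; such a set is in
B by the first two observations.  So T is in B and x is in D: D is closed
([limits_closed]).  The same holds for the complement of B.  Every point of X
is a limit, because an infinite connected T1 space has no isolated points and
X is Frechet-Urysohn, so D is clopen.  By connectedness of X it is empty or
everything, and therefore so is B ([Sc_connected]). *)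

(** * The Vietoris topology *)

Lemma CL_closed {X : topologicalType} (F : CL X) : closed (F : set X).
Proof. by have [] := set_mem (valP F). Qed.

Lemma CL_nonempty {X : topologicalType} (F : CL X) : (F : set X) !=set0.
Proof. by have [] := set_mem (valP F). Qed.

Lemma CL_ext {X : topologicalType} (F G : CL X) :
  (F : set X) = (G : set X) -> F = G.
Proof. exact: val_inj. Qed.

Definition mk_CL {X : topologicalType} (F : set X) (cF : closed F)
  (nF : F !=set0) : CL X := SigSub (mem_set (conj cF nF)).

(** Only nonempty open sets are allowed in <U>, so an empty W is treated apart
here and in the next lemma; nonempty closed sets neither lie in it nor meet it. *)
Lemma open_CL_subset {X : topologicalType} (W : set X) :
  open W -> open [set F : CL X | (F : set X) `<=` W].
Proof.
move=> oW; have [[w Ww]|/set0P/negP/negPn/eqP W0] := pselect (W !=set0); last first.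
  suff -> : [set F : CL X | (F : set X) `<=` W] = set0 by exact: open0.
  rewrite -subset0 => F /= FW; have [x /FW] := CL_nonempty F.
  by rewrite W0.
apply/open_vietoris; exists [set [set W]].
  move=> _ ->; split; [exact: finite_set1 | by exists W |].
  by move=> _ ->; split=> //; exists w.
rewrite bigcup_set1; apply/seteqP; split=> F /=.
  by move=> [+ _] x Fx => /(_ x Fx)[_ ->].
move=> FW; split=> [x /FW Wx|_ ->]; first by exists W.
by have [x Fx] := CL_nonempty F; exists x; split=> //; exact: FW.
Qed.

Lemma open_CL_meets {X : topologicalType} (W : set X) :
  open W -> open [set F : CL X | (F : set X) `&` W !=set0].
Proof.
move=> oW; have [[w Ww]|/set0P/negP/negPn/eqP W0] := pselect (W !=set0); last first.
  suff -> : [set F : CL X | (F : set X) `&` W !=set0] = set0 by exact: open0.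
  by rewrite -subset0 => F /= [x []]; rewrite W0.
apply/open_vietoris; exists [set [set W; setT]].
  move=> _ ->; split; [exact: finite_set2 | by exists W; left |].
  by move=> _ [] ->; split=> //; [exists w | exact: openT | exists w].
rewrite bigcup_set1; apply/seteqP; split=> F /=.
  by move=> [_]; apply; left.
move=> FW; split=> [x _|_ [] -> //]; first by exists setT => //; right.
by have [x Fx] := CL_nonempty F; exists x.
Qed.

(** Vietoris closeness to T, freed from finite families of open sets: a family
U with T in <U> enters only through its union W, an open set containing T, and
through finitely many points s of T, one in each member of U. *)
Lemma closure_CL {X : topologicalType} (B : set (CL X)) (T : CL X) :
  (forall (s : seq X) (W : set X), [set` s] `<=` (T : set X) ->
     open W -> (T : set X) `<=` W ->
     exists2 G : CL X, B G & [set` s] `<=` (G : set X) /\ (G : set X) `<=` W) ->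
  closure B T.
Proof.
move=> approx N; rewrite nbhsE => -[O [/open_vietoris[basis vB <-]]].
move=> [U BU [TU TmU]] ON; have [finU [V0 UV0] oU] := vB _ BU.
have /choice[f fP] : forall V : set X, exists x : X,
    U V -> (T : set X) x /\ V x.
  move=> V; have [/TmU[x TVx]|nUV] := pselect (U V); first by exists x.
  by have [x _] := CL_nonempty T; exists x.
have /finite_seqP[s sE] := finite_image f finU.
have obU : open (\bigcup_(V in U) V) by apply: bigcup_open => V /oU[].
have [|G BG [sG GU]] := approx s _ _ obU TU.
  by rewrite -sE => _ [V UV <-]; have [] := fP _ UV.
exists G; split=> //; apply: ON; exists U => //; split=> // V UV.
exists (f V); split; last by have [] := fP _ UV.
by apply: sG; rewrite -sE; exists V.
Qed.

Section add_point.
Variables (X : topologicalType) (T1 : accessible_space X).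

Lemma closed_add_point (F : CL X) (x : X) : closed ((F : set X) `|` [set x]).
Proof.
apply: closedU; first exact: CL_closed.
exact: accessible_closed_set1.
Qed.

Lemma nonempty_add_point (F : CL X) (x : X) :
  (F : set X) `|` [set x] !=set0.
Proof. by exists x; right. Qed.

Definition add_point (F : CL X) (x : X) : CL X :=
  mk_CL _ (closed_add_point F x) (nonempty_add_point F x).

Lemma add_point_continuous (F : CL X) : continuous (add_point F).
Proof.
move=> x N; rewrite nbhsE => -[O [/open_vietoris[basis vB <-]]].
move=> [U BU [FU FmU]] ON; have [finU _ oU] := vB _ BU.
have obU : open (\bigcup_(V in U) V) by apply: bigcup_open => V /oU[].
have nU : \forall y \near x, (\bigcup_(V in U) V) y.
  by apply: open_nbhs_nbhs; split=> //; apply: FU; right.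
have nm : \forall y \near x, forall V, U V -> add_point F y `&` V !=set0.
  have /finite_fsetP[D DE] := finU.
  have : nbhs x (\bigcap_(V in U)
      [set y | (add_point F y : set X) `&` V !=set0]).
    rewrite DE; apply: filter_bigI => V VD.
    have UV : U V by rewrite DE.
    have [y [[Fy|->] Vy]] := FmU V UV.
      by apply: nearW => z; exists y; split=> //; left.
    have : nbhs x V by apply: open_nbhs_nbhs; split=> //; have [] := oU _ UV.
    by apply: filterS => z Vz; exists z; split=> //; right.
  by apply: filterS => y Hy V UV; exact: Hy.
(* Otherwise [near=>] would introduce an element of CL X instead of a point. *)
suff : \forall y \near x, N (add_point F y) by [].
near=> y; apply: ON; exists U => //; split; last by near: y.
move=> z [Fz|->]; first by apply: FU; left.
by near: y.
Unshelve. all: by end_near. Qed.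

End add_point.

(** * Relatively clopen sets *)

(** The two halves are the premises on B in the definition of [connected A],
kept together because complementation exchanges them. *)
Definition clopen_in {T : topologicalType} (A B : set T) :=
  (exists2 C, open C & B = A `&` C) /\ (exists2 C, closed C & B = A `&` C).

Lemma clopen_inC {T : topologicalType} (A B : set T) :
  clopen_in A B -> clopen_in A (A `\` B).
Proof.
move=> [[O oO BO] [C cC BC]]; split; [exists (~` C)|exists (~` O)].
- exact: closed_openC.
- by rewrite BC setDIr setDv set0U setDE.
- exact: open_closedC.
- by rewrite BO setDIr setDv set0U setDE.
Qed.

Lemma clopen_in_connected {T : topologicalType} (A B K : set T) :
  clopen_in A B -> connected K -> K `<=` A -> K `&` B !=set0 -> K `<=` B.
Proof.
move=> [[O oO BO] [C cC BC]] cK KA KB; rewrite -setIidPl; apply: cK => //.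
- by exists O; rewrite // BO setIA (setIidl KA).
- by exists C; rewrite // BC setIA (setIidl KA).
Qed.

Lemma clopen_in_closure {T : topologicalType} (A B : set T) (x : T) :
  clopen_in A B -> A x -> closure B x -> B x.
Proof.
move=> [_ [C cC ->]] Ax xB; split=> //; apply: cC.
by apply: closure_subset xB; exact: subIsetr.
Qed.

(** * Nontrivial convergent sequences *)

(** Nontrivial convergent sequences with a named limit, stated without isolated
points.  Countability is required separately: the one-point compactification
of an uncountable discrete space satisfies the other three clauses. *)
Definition converging_set {X : topologicalType} (S : set X) (x : X) :=
  [/\ countable S, infinite_set S, S x &
      forall U, nbhs x U -> finite_set (S `\` U)].

Lemma countableU {T : Type} (A B : set T) :
  countable A -> countable B -> countable (A `|` B).
Proof.
by move=> cA cB; rewrite -bigcup2E; apply: bigcup_countable => // -[|[|]].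
Qed.

Lemma converging_set_super {X : topologicalType} (S T : set X) (x : X) :
  S `<=` T -> countable T ->
  (forall U, nbhs x U -> finite_set (T `\` U)) ->
  converging_set S x -> converging_set T x.
Proof.
move=> ST cT fT [_ iS Sx _]; split=> //; last exact: ST.
exact: sub_infinite_set ST iS.
Qed.

Lemma converging_setU {X : topologicalType} (S T : set X) (x : X) :
  converging_set S x -> converging_set T x -> converging_set (S `|` T) x.
Proof.
move=> Sx [cT _ _ fT]; have [cS _ _ fS] := Sx.
apply: converging_set_super Sx; first exact: subsetUl.
  exact: countableU.
by move=> U xU; rewrite setDUl finite_setU; split; [exact: fS | exact: fT].
Qed.

Lemma converging_setU1 {X : topologicalType} (S : set X) (x y : X) :
  converging_set S x -> converging_set (S `|` [set y]) x.
Proof.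
move=> Sx; have [cS _ _ fS] := Sx.
apply: converging_set_super Sx; first exact: subsetUl.
  exact: countableU.
move=> U xU; rewrite setDUl finite_setU; split; first exact: fS.
exact/finite_setD/finite_set1.
Qed.

Lemma converging_setI {X : topologicalType} (S W : set X) (x : X) :
  converging_set S x -> nbhs x W -> converging_set (S `&` W) x.
Proof.
move=> [cS iS Sx fS] xW; split.
- by apply: sub_countable cS; apply: subset_card_le; exact: subIsetl.
- move=> fSW; apply: iS; rewrite -(setUIDK S W) finite_setU; split=> //.
  exact: fS.
- by split=> //; exact: nbhs_singleton.
- by move=> U xU; apply: sub_finite_set (fS _ xU) => z [[]].
Qed.

Section hausdorff.
Variables (X : topologicalType) (hausX : hausdorff_space X).

(** Disjoint neighbourhoods of y and of the limit leave only finitely many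
points of S near y.  With finite sets being closed, this makes y isolated if it
is in S, and not adherent to S otherwise. *)
Lemma finite_nbhs_off_limit (S : set X) (x y : X) : converging_set S x ->
  y != x -> exists2 V, nbhs y V & finite_set (S `&` V).
Proof.
move=> [_ _ _ fS] yx.
have [V [yV [U [xU VU]]]] : exists V, nbhs y V /\ exists U, nbhs x U /\ V `&` U = set0.
  apply: contrapT => nVU; move/eqP: yx; apply; apply: hausX => V U yV xU.
  by apply/set0P/eqP => VU0; apply: nVU; exists V; split=> //; exists U.
exists V => //; apply: sub_finite_set (fS U xU) => z [Sz Vz]; split=> // Uz.
by have : set0 z by rewrite -VU.
Qed.

Lemma isolated_off_limit (S : set X) (x y : X) : converging_set S x ->
  S y -> y != x -> isolated S y.
Proof.
move=> Sx Sy yx; have [V yV fSV] := finite_nbhs_off_limit _ _ _ Sx yx.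
have T1 := hausdorff_accessible hausX.
split; first exact: mem_set.
have cV : closed ((S `&` V) `\ y).
  by apply: (accessible_finite_set_closed.1 T1); exact: finite_setD.
exists (V `&` ~` ((S `&` V) `\ y)).
  apply: filterI => //; apply: open_nbhs_nbhs; split; first exact: closed_openC.
  by case=> _; apply.
apply/seteqP; split=> [z [[Vz nz] Sz]|_ ->] /=.
  by apply: contrapT => zy; apply: nz.
by split=> //; split; [exact: nbhs_singleton | case=> _; apply].
Qed.

Lemma converging_set_closed (S : set X) (x : X) :
  converging_set S x -> closed S.
Proof.
move=> Sx y cSy; have [->|yx] := eqVneq y x; first by have [] := Sx.
apply: contrapT => nSy; have [V yV fSV] := finite_nbhs_off_limit _ _ _ Sx yx.
have cV : closed (S `&` V).
  exact: (accessible_finite_set_closed.1 (hausdorff_accessible hausX)).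
have [|z [Sz [Vz []]]] := cSy (V `&` ~` (S `&` V)); last by [].
apply: filterI => //; apply: open_nbhs_nbhs; split; first exact: closed_openC.
by case.
Qed.

Lemma limit_not_isolated (S : set X) (x : X) :
  converging_set S x -> ~ isolated S x.
Proof.
move=> [_ iS _ fS] [_ [V xV VS]]; apply: iS.
by rewrite -(setUIDK S V) setIC VS finite_setU; split; [exact: finite_set1 | exact: fS].
Qed.

Lemma converging_setP (S : set X) :
  nontrivial_convergent_sequence S <-> exists x, converging_set S x.
Proof.
split.
  move=> [Snat [x [[Sx _] _ fS]]]; exists x; split=> //.
    by rewrite /countable; move: Snat; rewrite card_eq_le => /andP[].
  by apply/infiniteP; move: Snat; rewrite card_eq_le => /andP[].
move=> [x cS]; have [ctS iS Sx fS] := cS; split; first exact: eq_card_nat.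
exists x; split=> //; first by split=> //; exact: limit_not_isolated.
move=> y Sy niy; apply: contrapT => /eqP yx; apply: niy.
exact: isolated_off_limit cS Sy yx.
Qed.

Lemma converging_set_CL (S : set X) (x : X) : converging_set S x ->
  exists2 T : CL X, Sc X T & (T : set X) = S.
Proof.
move=> cS; have [_ _ Sx _] := cS.
have nS : S !=set0 by exists x.
exists (mk_CL _ (converging_set_closed _ _ cS) nS) => //.
by apply/converging_setP; exists x.
Qed.

(** The range of a sequence of points distinct from x that converges to x is
infinite: a finite range would be closed, and its complement would be a
neighbourhood of x that the sequence never enters. *)
Lemma converging_set_exists (W : set X) (x : X) : frechet_urysohn X ->
  ~ open [set x] -> nbhs x W ->
  exists2 S, converging_set S x & S `<=` W.
Proof.
move=> fuX nox xW; have [|u [ux cu]] := fuX [set~ x] x.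
  move=> N xN; apply: contrapT => N0; apply: nox.
  suff <- : N° = [set x] by exact: open_interior.
  apply/seteqP; split=> [z /interior_subset Nz|_ -> //].
  by apply: contrapT => zx; apply: N0; exists z.
suff cS : converging_set (range u `|` [set x]) x.
  by exists ((range u `|` [set x]) `&` W); [exact: converging_setI|exact: subIsetr].
split.
- apply: countableU => //; exact: sub_countable (card_image_le _ _) _.
- rewrite finite_setU => -[fu _].
  have cr := (accessible_finite_set_closed.1 (hausdorff_accessible hausX)) _ fu.
  have : nbhs x (~` range u).
    apply: open_nbhs_nbhs; split; first exact: closed_openC.
    by case=> n _ /ux.
  by move=> /cu[n _ /(_ n (leqnn n))]; apply; exists n.
- by right.
- move=> U xU; have [n _ un] := cu U xU.
  rewrite setDUl finite_setU; split; last exact/finite_setD/finite_set1.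
  apply: sub_finite_set (finite_image u (finite_II n)).
  move=> _ [[m _ <-] nUm]; exists m => //=; rewrite ltnNge; apply/negP => nm.
  by apply: nUm; exact: un.
Qed.

(** * Relatively clopen sets of sequences *)

Section clopen_Sc.
Variables (B : set (CL X)) (clB : clopen_in (Sc X) B).
Hypothesis cX : connected [set: X].

Let BSc (S : CL X) : B S -> exists x, converging_set S x.
Proof. by move: clB => [[C _ ->] _] [/converging_setP]. Qed.

(** The limit of S belongs to S, so S itself is among the sets obtained from S
by adding a point, and these form a connected family. *)
Lemma clopen_add_point (S : CL X) (y : X) : B S ->
  B (add_point _ (hausdorff_accessible hausX) S y).
Proof.
move=> BS; have [x Sx] := BSc S BS.
set f := add_point _ _ S.
suff : range f `<=` B by apply; exists y.
apply: (clopen_in_connected (Sc X) _ _ clB).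
- apply: connected_continuous_connected => //.
  apply/continuous_subspaceT; exact: add_point_continuous.
- move=> _ [z _ <-]; apply/converging_setP; exists x.
  exact: converging_setU1.
- exists S; split=> //; exists x => //; apply: CL_ext.
  by apply: setUidl => _ ->; have [] := Sx.
Qed.

Lemma clopen_add_seq (S : CL X) (s : seq X) : B S ->
  exists2 T : CL X, B T & (T : set X) = (S : set X) `|` [set` s].
Proof.
move=> BS; elim: s => [|y s [T BT TE]].
  by exists S => //; rewrite set_nil setU0.
exists (add_point _ (hausdorff_accessible hausX) T y).
  exact: clopen_add_point.
rewrite [LHS](_ : _ = (T : set X) `|` [set y]) // TE.
apply/seteqP; split=> z /=.
  move=> [[Sz|sz]|->]; [by left | right | right]; rewrite inE.
    by apply/orP; right.
  by rewrite eqxx.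
by move=> [Sz|]; [left; left | rewrite inE => /predU1P[->|sz]; [right | left; right]].
Qed.

(** T is a Vietoris limit of sets S `|` s with s a finite part of T. *)
Lemma clopen_superset (S T : CL X) : B S -> Sc X T ->
  (S : set X) `<=` (T : set X) -> B T.
Proof.
move=> BS ScT ST; apply: (clopen_in_closure _ _ _ clB ScT).
apply: closure_CL => s W sT _ TW.
have [G BG GE] := clopen_add_seq S s BS; exists G => //; rewrite GE.
by split=> [z sz|z [/ST|/sT] /TW//]; right.
Qed.

End clopen_Sc.

(** The union of S and T can be reached by enlarging S, within B, and by
enlarging T, within the complement of B if T were not in B. *)
Lemma clopen_same_limit (B : set (CL X)) (S T : CL X) (x : X) :
  connected [set: X] -> clopen_in (Sc X) B ->
  converging_set S x -> converging_set T x -> B S -> B T.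
Proof.
move=> cX clB Sx Tx BS.
have [G ScG GE] := converging_set_CL _ _ (converging_setU _ _ _ Sx Tx).
have ScT : Sc X T by apply/converging_setP; exists x.
have BG : B G by apply: (clopen_superset _ clB cX S) => //; rewrite GE; exact: subsetUl.
apply: contrapT => nBT.
have [] // : (Sc X `\` B) G.
apply: (clopen_superset _ (clopen_inC _ _ clB) cX T) => //.
by rewrite GE; exact: subsetUr.
Qed.

Definition limits (B : set (CL X)) : set X :=
  [set x | exists2 S : CL X, B S & converging_set S x].

Section limits.
Hypotheses (cX : connected [set: X]) (fuX : frechet_urysohn X).
Hypothesis no_isolated : forall x : X, ~ open [set x].

(** A sequence converging to a limit d of B near x, taken inside the given open
set W, is in B whatever it is, since B only depends on limits; adding finitely
many points of a sequence converging to x then gives a member of B that is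
Vietoris-close to that sequence. *)
Lemma limits_closed (B : set (CL X)) :
  clopen_in (Sc X) B -> closed (limits B).
Proof.
move=> clB x clx.
have [T Tx _] := converging_set_exists _ _ fuX (no_isolated x) filterT.
have [G ScG GE] := converging_set_CL _ _ Tx.
exists G; last by rewrite GE.
apply: (clopen_in_closure _ _ _ clB ScG).
apply: closure_CL => s W sG oW GW.
have Wx : W x by apply: GW; rewrite GE; have [] := Tx.
have [d [[S BS Sd] Wd]] := clx W (open_nbhs_nbhs (conj oW Wx)).
have [S' S'd S'W] := converging_set_exists _ _ fuX (no_isolated d)
  (open_nbhs_nbhs (conj oW Wd)).
have [H ScH HE] := converging_set_CL _ _ S'd.
have BH : B H by apply: (clopen_same_limit _ S _ d) => //; rewrite HE.
have [K BK KE] := clopen_add_seq _ clB cX H s BH.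
exists K => //; rewrite KE HE; split=> [z sz|z [/S'W//|/sG/GW//]]; by right.
Qed.

(** The limits of B and of its complement are disjoint because membership in B
is determined by the limit, and exhaust X because each point is a limit. *)
Lemma limits_setD (B : set (CL X)) : clopen_in (Sc X) B ->
  limits (Sc X `\` B) = ~` limits B.
Proof.
move=> clB; apply/seteqP; split=> x.
  move=> [S [ScS nBS] Sx] [T BT Tx]; apply: nBS.
  exact: (clopen_same_limit _ T _ x).
move=> nx.
have [T Tx _] := converging_set_exists _ _ fuX (no_isolated x) filterT.
have [G ScG GE] := converging_set_CL _ _ Tx.
have Gx : converging_set G x by rewrite GE.
by exists G => //; split=> // BG; apply: nx; exists G.
Qed.

Lemma Sc_connected : connected (Sc X).
Proof.
move=> B [S BS] opB clB; have coB : clopen_in (Sc X) B by split.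
have BSc : B `<=` Sc X by case: opB => C _ ->; exact: subIsetl.
have limT : limits B = setT.
  apply: cX.
  - by have /converging_setP[x Sx] := BSc _ BS; exists x; exists S.
  - exists (limits B); last by rewrite setTI.
    rewrite -[limits B]setCK -limits_setD //.
    exact/closed_openC/limits_closed/clopen_inC.
  - by exists (limits B); [exact: limits_closed | rewrite setTI].
apply/seteqP; split=> // T /converging_setP[x Tx].
have [S' BS' S'x] : limits B x by rewrite limT.
exact: (clopen_same_limit _ S' _ x).
Qed.

End limits.
End hausdorff.

Lemma connected_infinite_no_isolated {X : topologicalType} (x : X) :
  accessible_space X -> infinite_set [set: X] -> connected [set: X] ->
  ~ open [set x].
Proof.
move=> T1 infX cX ox; apply: infX.
suff <- : [set x] = setT by exact: finite_set1.
apply: cX; first by exists x.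
- by exists [set x]; rewrite ?setTI.
- by exists [set x]; rewrite ?setTI //; exact: accessible_closed_set1.
Qed.

Lemma exists_non_isolated {X : topologicalType} :
  ~ discrete_space X -> exists x : X, ~ open [set x].
Proof.
move=> ndX; apply: contrapT => iso; apply: ndX => A.
have -> : A = \bigcup_(x in A) [set x].
  by apply/seteqP; split=> [x Ax|_ [x Ax ->] //]; exists x.
by apply: bigcup_open => x _; apply: contrapT => nox; apply: iso; exists x.
Qed.

(** * Connectedness of the underlying space *)

(** A clopen set A around a non-isolated point p is the whole space: all
sequences lie in A, because those which do form a nonempty clopen family, and
any point v appears in a sequence converging to p. *)
Lemma connected_of_Sc {X : topologicalType} :
  hausdorff_space X -> ~ discrete_space X -> frechet_urysohn X ->
  connected (Sc X) -> connected [set: X].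
Proof.
move=> hausX ndX fuX cSc B B0 [O oO BO] [C cC BC].
have oB : open B by rewrite BO setTI.
have cB : closed B by rewrite BC setTI.
have [p nop] := exists_non_isolated ndX.
have halves (A : set X) : open A -> closed A -> A p -> A = setT.
  move=> oA cA Ap.
  have [S Sp SA] := converging_set_exists _ hausX A _ fuX nop
    (open_nbhs_nbhs (conj oA Ap)).
  have [G ScG GE] := converging_set_CL _ hausX _ _ Sp.
  have inA : Sc X `&` [set F : CL X | (F : set X) `<=` A] = Sc X.
    apply: cSc; first by exists G; split=> //=; rewrite GE.
    - by exists [set F : CL X | (F : set X) `<=` A] => //; exact: open_CL_subset.
    - exists (~` [set F : CL X | (F : set X) `&` ~` A !=set0]).
        exact/open_closedC/open_CL_meets/closed_openC.
      congr (_ `&` _); apply/seteqP; split=> F /=.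
        by move=> FA [x [/FA]].
      by move=> FA x Fx; apply: contrapT => nAx; apply: FA; exists x.
  rewrite -subTset => v _.
  have [H ScH HE] := converging_set_CL _ hausX _ _ (converging_setU1 _ _ v Sp).
  have [_ /= HA] : (Sc X `&` [set F : CL X | (F : set X) `<=` A]) H.
    by rewrite inA.
  by apply: HA; rewrite HE; right.
(* The point p need not be in B, but then the complement of B qualifies. *)
have [Bp|nBp] := pselect (B p); first exact: halves.
have BT : ~` B = setT.
  by apply: halves => //; [exact: closed_openC | exact: open_closedC].
by have [b Bb] := B0; have : (~` B) b by rewrite BT.
Qed.

(* Spaces are Hausdorff. T1 would not suffice: for the topological sum X of two
   infinite cofinite spaces, Sc X is empty, hence connected, but X is not. *)
Theorem corollary2p3 (X : topologicalType) (hausX : hausdorff_space X)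
    (infX : infinite_set [set: X]) (ndX : ~ discrete_space X)
    (fuX : frechet_urysohn X) :
  connected (Sc X) <-> connected [set: X].
Proof.
split; first exact: connected_of_Sc.
move=> cX; apply: Sc_connected => // x.
exact: connected_infinite_no_isolated (hausdorff_accessible hausX) infX cX.
Qed.
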